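(* Let $\bar x\in\mathcal R=\{x\in S:\ G(x)\subseteq C\}$ be a local weakly efficient solution to the vector optimization problem of minimizing $f$ (with respect to the cone $K$) over $\mathcal R$. Suppose that: (i) $f$ is $B$-differentiable at $\bar x$; (ii) $G$ is lower semicontinuous in a neighbourhood of $\bar x$ and is metrically $C$-increasing around $\bar x$, relative to $S$; (iii) $G$ admits $H_G(\bar x;\cdot):\mathbb X\rightrightarrows\mathbb Z$ as an outer prederivative at $\bar x$; (iv) $S$ is locally convex near $\bar x$; (v) $f$ is Fréchet differentiable at $\bar x$, with Fréchet derivative $\mathrm Df(\bar x)$; (vi) $H_G(\bar x;\cdot)$ is a fan finitely generated by $\mathcal G=\mathrm{conv}\{\Lambda_1,\dots,\Lambda_p\}$, with $\Lambda_1,\dots,\Lambda_p\in\mathcal L(\mathbb X,\mathbb Z)$, i.e. $H_G(\bar x;v)=\{\Lambda v:\ \Lambda\in\mathcal G\}$ for all $v\in\mathbb X$; (vii) the following qualification condition holds: $$\Bigl(\bigcap_{i=1}^p\mathrm{int}\,\Lambda_i^{-1}(C)\Bigr)\cap\mathrm{int}\,\mathrm T(S;\bar x)\neq\varnothing.$$ Then there exist $y^*\in K^{\oplus}\setminus\{\mathbf 0^*\}$ and, for each $i=1,\dots,p$, an element $x_i^*\in\mathbb X^*$ and a sequence $(z^*_{i,n})_n$ in $\mathbb Z^*$, with $z^*_{i,n}\in C^{\ominus}$ for all $n$ and $\Lambda_i^*z^*_{i,n}\to x_i^*$ in $\mathbb X^*$ as $n\to\infty$, such that $$\mathbf 0^*\in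 \mathrm Df(\bar x)^*y^*+\sum_{i=1}^px_i^*+\mathrm N(S;\bar x).$$
   Context: Setting: $\mathbb X,\mathbb Y,\mathbb Z$ are real Banach spaces; $K\subseteq\mathbb Y$ is a (proper) convex cone with $\mathrm{int}\,K\neq\varnothing$, inducing the partial order $y_1\le_K y_2\iff y_2-y_1\in K$; $C\subseteq\mathbb Z$ is a proper closed convex cone, $C\neq\{\mathbf 0\}$; $S\subseteq\mathbb X$ is nonempty and closed; $f:\mathbb X\to\mathbb Y$ is a mapping; $G:\mathbb X\rightrightarrows\mathbb Z$ is a set-valued mapping with $G(x)\neq\varnothing$ for every $x\in\mathbb X$. $\mathrm B(x,r)$ is the closed ball with center $x$ and radius $r$, and $\mathbb B$ is the closed unit ball centered at $\mathbf 0$. For a set $A$, $\mathrm B(A,r)=\{z:\ \mathrm{dist}(z,A)\le r\}$ is its $r$-enlargement. $\mathcal L(\mathbb X,\mathbb Z)$ is the Banach space of bounded linear operators with the operator norm; $\mathbb X^*=\mathcal L(\mathbb X,\mathbb R)$ carries the dual norm; $\mathbf 0^*$ is the null vector of a dual space; $\Lambda^*$ is the adjoint of $\Lambda$. For a cone $Q$ in a Banach space, $Q^{\oplus}=\{q^*:\ \langle q^*,q\rangle\ge0,\ \forall q\in Q\}$ and $Q^{\ominus}=-Q^{\oplus}$. Local weak efficiency: $\bar x\in\mathcal R$ is a local weakly efficient solution to the problem of minimizing $f$ over $\mathcal R$ if there is $\delta>0$ with $f(\mathcal R\cap \mathrm B(\bar x,\delta))\cap[f(\bar x)-\mathrm{int}\,K]=\varnothing$.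 $f$ is $B$-differentiable at $\bar x$ if there is a positively homogeneous and continuous mapping $\mathrm D_Bf(\bar x;\cdot):\mathbb X\to\mathbb Y$ with $\lim_{x\to\bar x}\frac{f(x)-f(\bar x)-\mathrm D_Bf(\bar x;x-\bar x)}{\|x-\bar x\|}=0$. $G$ is lower semicontinuous (l.s.c.) at $x$ if for every open $V$ with $V\cap G(x)\ne\varnothing$ there is a neighbourhood $U$ of $x$ with $G(u)\cap V\neq\varnothing$ for all $u\in U$. $G$ is metrically $C$-increasing around $\bar x$, relative to $S$, if there exist $\delta>0$ and $\alpha>1$ such that for all $x\in \mathrm B(\bar x,\delta)\cap S$ and $r\in(0,\delta)$ there is $z\in \mathrm B(x,r)\cap S$ with $\mathrm B(G(z),\alpha r)\subseteq \mathrm B(G(x)+C,r)$. A positively homogeneous set-valued mapping $H_G(\bar x;\cdot):\mathbb X\rightrightarrows\mathbb Z$ (i.e. $H_G(\bar x;tv)=tH_G(\bar x;v)$ for $t>0$) is an outer prederivative of $G$ at $\bar x$ if for every $\epsilon>0$ there is $\delta>0$ with $G(x)\subseteq G(\bar x)+H_G(\bar x;x-\bar x)+\epsilon\|x-\bar x\|\mathbb B$ for all $x\in \mathrm B(\bar x,\delta)$. $S$ is locally convex near $\bar x$ if $S\cap \mathrm B(\bar x,r)$ is convex for some $r>0$. Contingent cone: $\mathrm T(S;\bar x)=\{v\in\mathbb X:\ \exists v_n\to v,\ \exists t_n\downarrow0:\ \bar x+t_nv_n\in S\ \forall n\in\mathbb N\}$. Normal cone (for $S$ locally convex near $\bar x$):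 $\mathrm N(S;\bar x)=\mathrm T(S;\bar x)^{\ominus}$. *)

(* Defs.v *)
From HB Require Import structures.
From mathcomp Require Import all_boot all_order all_algebra.
From mathcomp Require Import all_classical all_reals all_analysis.

Set Implicit Arguments.
Unset Strict Implicit.
Unset Printing Implicit Defensive.

Import Order.TTheory GRing.Theory Num.Theory.
Import numFieldNormedType.Exports.

Local Open Scope classical_set_scope.
Local Open Scope ring_scope.

Section Sets.
Context {R : realType}.
Implicit Types E F : normedModType R.

Definition cball {E} (x : E) (r : R) : set E := closed_ball_ Num.norm x r.

Definition enlargement {E} (A : set E) (r : R) : set E :=
  [set z | (edist_inf A z <= r%:E)%E].

Definition set_add {E} (A B : set E) : set E := [set a + b | a in A & b in B].

(* The origin is not required to belong to a cone. *)
Definition cone {E} (Q : set E) : Prop :=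
  Q !=set0 /\ forall (t : R) q, 0 < t -> Q q -> Q (t *: q).

Definition convex_cone {E} (Q : set E) : Prop := cone Q /\ convex_set Q.

Definition locally_convex_near {E} (S : set E) (x : E) : Prop :=
  exists2 r : R, 0 < r & convex_set (S `&` cball x r).

Definition contingent_cone {E} (S : set E) (x : E) : set E :=
  [set v | exists (v_ : nat -> E) (t_ : nat -> R),
    [/\ v_ @ \oo --> v,
        forall n, 0 < t_ n,
        t_ @ \oo --> 0 &
        forall n, S (x + t_ n *: v_ n)]].

(* The space L(E, F), as a subset of the lmodType of all functions E -> F. *)
Definition bounded_operator {E F} : set (E -> F) :=
  [set L | linear L /\ continuous L].

Definition operator_norm {E F} (L : E -> F) : R :=
  sup [set `|L x| | x in cball 0 1].

Definition dual_cone {E} (Q : set E) : set (E -> R^o) :=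
  [set q | bounded_operator q /\ forall x, Q x -> (0 : R) <= q x].

Definition neg_dual_cone {E} (Q : set E) : set (E -> R^o) :=
  [set - q | q in dual_cone Q].

Definition normal_cone {E} (S : set E) (x : E) : set (E -> R^o) :=
  neg_dual_cone (contingent_cone S x).

Definition convex_hull (M : lmodType R) (A : set M) : set M :=
  smallest (fun B : set M => convex_set B) A.

End Sets.

Section Mappings.
Context {R : realType}.
Implicit Types X Y Z : normedModType R.

Definition B_differentiable {X Y} (f : X -> Y) (x0 : X) : Prop :=
  exists D : X -> Y,
    [/\ forall (t : R) v, 0 < t -> D (t *: v) = t *: D v,
        continuous D &
        `|x - x0|^-1 *: (f x - f x0 - D (x - x0)) @[x --> x0^'] --> (0 : Y)].

Definition lower_semicontinuous_at {X Z} (G : X -> set Z) (x : X) : Prop :=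
  forall V : set Z, open V -> V `&` G x !=set0 ->
    \forall u \near x, G u `&` V !=set0.

Definition metrically_increasing {X Z} (C : set Z) (S : set X)
    (G : X -> set Z) (x0 : X) : Prop :=
  exists delta alpha : R, [/\ 0 < delta, 1 < alpha &
    forall x r, (cball x0 delta `&` S) x -> 0 < r < delta ->
      exists2 z, (cball x r `&` S) z &
        enlargement (G z) (alpha * r) `<=` enlargement (set_add (G x) C) r].

Definition positively_homogeneous {X Z} (H : X -> set Z) : Prop :=
  forall (t : R) v, 0 < t -> H (t *: v) = [set t *: w | w in H v].

Definition outer_prederivative {X Z} (G : X -> set Z) (x0 : X)
    (H : X -> set Z) : Prop :=
  positively_homogeneous H /\
  forall eps : R, 0 < eps -> exists2 delta : R, 0 < delta &
    forall x, cball x0 delta x ->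
      G x `<=` set_add (set_add (G x0) (H (x - x0)))
                       [set (eps * `|x - x0|) *: b | b in cball 0 1].

Definition fan_generated_by {X Z} (H : X -> set Z) (A : set (X -> Z)) : Prop :=
  forall v, H v = [set L v | L in A].

Definition feasible_set {X Z} (S : set X) (G : X -> set Z) (C : set Z) : set X :=
  [set x | S x /\ G x `<=` C].

Definition locally_weakly_efficient {X Y} (f : X -> Y) (K : set Y) (A : set X)
    (x0 : X) : Prop :=
  A x0 /\ exists2 delta : R, 0 < delta &
    (f @` (A `&` cball x0 delta)) `&` [set f x0 - k | k in K°] = set0.

End Mappings.

(* Main.v *)
(* The multipliers come from exact penalization, followed by a Hahn-Banach
   argument in [Y * Z^p].  Because the metric increase enlarges [G] faster than
   the step length, a single step from [x] in [S] with [G x] within [rho] of [C]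
   reaches a feasible point at distance at most [kappa * rho].  Hence moving
   from [x0] along a direction [v] of [S] and correcting back to feasibility
   costs at most [kappa * t * sum_i dist (L i v, C) + o(t)], and weak efficiency
   says that [f] cannot decrease by an interior direction of [K].  This is an
   inequality bounding a sublinear function on [Y * Z^p] from below on a convex
   cone; a linear functional sandwiched between the two has the required
   components.  The Lipschitz penalty bounds the components [zs i], so the
   closures are not needed and the sequences can be taken constant. *)

From HB Require Import structures.
Require Import Defs.
From mathcomp Require Import all_boot all_order all_algebra.
From mathcomp Require Import all_classical all_reals all_analysis.
From mathcomp Require Import ring lra.

Import Order.TTheory GRing.Theory Num.Theory.
Import numFieldNormedType.Exports.

Local Open Scope classical_set_scope.
Local Open Scope ring_scope.

(** * Sublinear functions and a Mazur-Orlicz sandwich theorem *)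

Section Sublinear.
Context {R : realType} {W : lmodType R}.
Implicit Types (q : W -> R) (D : set (W * R)).

Definition sublinear q : Prop :=
  (forall x y, q (x + y) <= q x + q y) /\
  (forall (t : R) x, 0 < t -> q (t *: x) = t * q x).

Lemma sublinear0 q : sublinear q -> q 0 = 0.
Proof.
move=> [_ qZ]; have := qZ 2 0 (ltr0Sn _ 1); rewrite scaler0 => q0.
by apply/eqP; rewrite -(addrK (q 0) (q 0)) -mulr2n -mulr_natl -q0 subrr.
Qed.

Lemma sublinearN_le q x : sublinear q -> - q (- x) <= q x.
Proof.
move=> sq; have := sq.1 x (- x).
by rewrite subrr sublinear0// -lerBlDr sub0r.
Qed.

(* An element [(w, b)] of [D] stands for the constraint [b <= l w] on the linear
   minorants [l] of [q]. *)
Definition constraint_cone D q : Prop :=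
  [/\ D (0, 0),
      forall d e, D d -> D e -> D (d.1 + e.1, d.2 + e.2),
      forall (t : R) d, 0 < t -> D d -> D (t *: d.1, t * d.2) &
      forall d, D d -> d.2 <= q d.1].

(** For a constraint cone [D], the linear functions below this one are exactly the linear minorants
    of [q] satisfying every constraint of [D], so constraints turn into a mere upper bound. *)
Definition inf_regularization q D w : R := inf [set q (w + d.1) - d.2 | d in D].

(** The infimum is finite because [d.2 <= q d.1 <= q (w + d.1) + q (- w)]. *)
Lemma inf_regularization_lbound q D w : sublinear q -> constraint_cone D q ->
  lbound [set q (w + d.1) - d.2 | d in D] (- q (- w)).
Proof.
move=> sq [_ _ _ Dq] _ [d Dd <-]; rewrite lerBrDl.
apply: le_trans (_ : q d.1 - q (- w) <= _).
  by rewrite lerD2r; exact: Dq.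
by rewrite lerBlDr -[X in q X <= _](addKr w) addrC; exact: sq.1.
Qed.

Lemma inf_regularization_le q D w d : sublinear q -> constraint_cone D q ->
  D d -> inf_regularization q D w <= q (w + d.1) - d.2.
Proof.
move=> sq cD Dd; apply: ge_inf; last by exists d.
by exists (- q (- w)); exact: inf_regularization_lbound.
Qed.

Lemma le_inf_regularization q D w a : D (0, 0) ->
  (forall d, D d -> a <= q (w + d.1) - d.2) -> a <= inf_regularization q D w.
Proof.
move=> D0 aq; apply: lb_le_inf; first by exists (q (w + 0) - 0), (0, 0).
by move=> _ [d Dd <-]; exact: aq.
Qed.

(** Closure of [D] under scaling gives homogeneity, and closure under addition gives
    subadditivity. *)
Lemma inf_regularization_sublinear q D : sublinear q -> constraint_cone D q ->
  sublinear (inf_regularization q D).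
Proof.
move=> sq cD; have [D0 DD DZ Dq] := cD.
(* This half of homogeneity suffices: used with [t^-1] and [t *: x], it yields the reverse
   inequality. *)
have Zle t x : 0 < t ->
    t * inf_regularization q D x <= inf_regularization q D (t *: x).
  move=> t0; apply: le_inf_regularization => // d Dd.
  have ti0 : 0 < t^-1 by rewrite invr_gt0.
  have := inf_regularization_le _ _ x _ sq cD (DZ _ _ ti0 Dd) => /=.
  rewrite -(ler_pM2l t0) mulrBr mulrA mulfV ?gt_eqF// mul1r => /le_trans; apply.
  by rewrite -sq.2// scalerDr scalerA mulfV ?gt_eqF// scale1r.
split=> [x y|t x t0]; last first.
  apply/eqP; rewrite eq_le Zle// andbT -ler_pdivrMl//.
  have ti0 : 0 < t^-1 by rewrite invr_gt0.
  have := Zle _ (t *: x) ti0.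
  by rewrite scalerA mulVf ?gt_eqF// scale1r.
rewrite -lerBlDr; apply: le_inf_regularization => // d Dd.
rewrite lerBlDr -lerBlDl; apply: le_inf_regularization => // e De.
rewrite lerBlDl.
apply: le_trans (inf_regularization_le _ _ (x + y) _ sq cD (DD _ _ Dd De)) _.
rewrite /= addrACA; have := sq.1 (x + d.1) (y + e.1); lra.
Qed.

Lemma inf_regularization_le_self q D w : sublinear q -> constraint_cone D q ->
  inf_regularization q D w <= q w.
Proof.
move=> sq cD; have [D0 _ _ _] := cD.
by have := inf_regularization_le _ _ w _ sq cD D0; rewrite /= addr0 subr0.
Qed.

Definition minimal_sublinear q : Prop :=
  sublinear q /\ forall q', sublinear q' -> (forall w, q' w <= q w) -> q' = q.

(* Minimality forces [q (- x) = - q x]: otherwise regularizing along the ray of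
   [x] with slope [q x] would give a smaller sublinear function. *)
Lemma minimal_sublinear_linear q : minimal_sublinear q ->
  linear (q : W -> R^o).
Proof.
move=> [sq qmin]; have [qD qZ] := sq; have q0 := sublinear0 _ sq.
have qN x : q (- x) = - q x.
  pose D := [set (t *: x, t * q x) | t in [set t : R | 0 <= t]].
  have cD : constraint_cone D q.
    split.
    - by exists 0 => //=; rewrite scale0r mul0r.
    - move=> _ _ [s s0 <-] [t t0 <-]; exists (s + t); first exact: addr_ge0.
      by rewrite scalerDl mulrDl.
    - move=> t _ t0 [s s0 <-]; exists (t * s); first exact: mulr_ge0 (ltW t0) _.
      by rewrite scalerA mulrA.
    - move=> _ [t t0 <-] /=; move: t0; rewrite /= le_eqVlt => /predU1P[<-|t0].
        by rewrite scale0r mul0r q0.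
      by rewrite qZ.
  have <- := qmin _ (inf_regularization_sublinear _ _ sq cD)
    (fun w => inf_regularization_le_self _ _ w sq cD).
  apply/eqP; rewrite eq_le; apply/andP; split; last first.
    rewrite lerNl; apply: sublinearN_le.
    exact: inf_regularization_sublinear.
  have Dx : D (x, q x) by exists 1; rewrite /= ?ler01// scale1r mul1r.
  (* The constraint at [x] itself bounds the regularization at [- x] by [q 0 - q x]. *)
  have := inf_regularization_le _ _ (- x) _ sq cD Dx.
  rewrite /= addNr q0 sub0r => /le_trans; apply.
  by rewrite lerN2; exact: inf_regularization_le_self.
have qA x y : q (x + y) = q x + q y.
  apply/eqP; rewrite eq_le qD/= -lerBrDr -(qN y).
  by rewrite -{1}(addrK y x); exact: qD.
move=> a x y; rewrite qA; congr (_ + _).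
have [a0|a0|->] := ltgtP a 0; last 2 first.
- exact: qZ.
- by rewrite !scale0r.
rewrite -[a]opprK scaleNr qN (qZ (- a)) ?oppr_gt0//.
by rewrite -mulNr.
Qed.

(** Zorn's lemma: the pointwise infimum of a nonempty chain is again sublinear, and it is finite
    since every member is bounded below by [- q (- w)]. *)
Lemma minimal_sublinear_below q : sublinear q ->
  exists2 l, minimal_sublinear l & forall w, l w <= q w.
Proof.
move=> sq; pose T := {l : W -> R | sublinear l /\ forall w, l w <= q w}.
(* The order is reversed, so that a maximal element is a minimal function. *)
pose le (l m : T) := `[< forall w, sval m w <= sval l w >].
have leqT l m : le l m -> forall w, sval m w <= sval l w by move=> /asboolP.
case: (Zorn (R := le)) => [l|l m n lm mn|l m lm ml|A Atot|l lmax].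
- exact/asboolP.
- by apply/asboolP => w; exact: le_trans (leqT _ _ mn w) (leqT _ _ lm w).
- case: l m lm ml => [l Hl] [m Hm] /leqT/= lm /leqT/= ml; apply: eq_exist.
  by apply/funext => w; apply/eqP; rewrite eq_le lm ml.
(* A real infimum over the empty set is only a default value; [q] itself bounds the empty chain. *)
- have [A0|/set0P[a Aa]] := eqVneq A set0.
    exists (exist _ q (conj sq (fun w => lexx (q w)))) => s.
    by rewrite A0.
  pose m w := inf [set sval l w | l in A].
  have lbm w : lbound [set sval l w | l in A] (- q (- w)).
    move=> _ [[l [sl lq]] _ <-] /=.
    by apply: le_trans (sublinearN_le _ w sl); rewrite lerN2.
  have mle l w : A l -> m w <= sval l w.
    by move=> Al; apply: ge_inf; [exists (- q (- w)); exact: lbm|exists l].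
  have lem w c : (forall l, A l -> c <= sval l w) -> c <= m w.
    move=> cA; apply: lb_le_inf; first by exists (sval a w), a.
    by move=> _ [l Al <-]; exact: cA.
  have Zle t x : 0 < t -> t * m x <= m (t *: x).
    move=> t0; apply: lem => l Al; rewrite (svalP l).1.2// ler_pM2l//.
    exact: mle.
  have sm : sublinear m.
    split=> [x y|t x t0]; last first.
      apply/eqP; rewrite eq_le Zle// andbT -ler_pdivrMl//.
      have ti0 : 0 < t^-1 by rewrite invr_gt0.
      have := Zle _ (t *: x) ti0.
      by rewrite scalerA mulVf ?gt_eqF// scale1r.
    rewrite -lerBlDr; apply: (lem x) => l Al; rewrite lerBlDr -lerBlDl.
    apply: (lem y) => l' Al'; rewrite lerBlDl.
    (* The pointwise smaller of the two chain members serves for both [x] and [y]. *)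
    have [/leqT ll'|/leqT l'l] := Atot _ _ Al Al'.
      apply: le_trans (mle _ _ Al') _; apply: le_trans ((svalP l').1.1 x y) _.
      by rewrite lerD2r.
    apply: le_trans (mle _ _ Al) _; apply: le_trans ((svalP l).1.1 x y) _.
    by rewrite lerD2l.
  have mq w : m w <= q w by apply: le_trans (mle _ w Aa) ((svalP a).2 w).
  exists (exist _ m (conj sm mq)) => l Al; apply/asboolP => w /=.
  exact: mle.
exists (sval l); last exact: (svalP l).2.
split=> [|m sm ml]; first exact: (svalP l).1.
have mq w : m w <= q w by apply: le_trans (ml w) ((svalP l).2 w).
have := lmax (exist _ m (conj sm mq)).
by move=> <- //; exact/asboolP.
Qed.

(** A minimal sublinear function below the regularization is linear; its value at [- d.1] is at most
    [q 0 - d.2], which is the constraint [d]. *)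
Lemma mazur_orlicz q D : sublinear q -> constraint_cone D q ->
  exists l : W -> R^o, [/\ linear l, forall w, l w <= q w &
    forall d, D d -> d.2 <= l d.1].
Proof.
move=> sq cD; have sr := inf_regularization_sublinear _ _ sq cD.
have [l lmin lr] := minimal_sublinear_below _ sr.
exists l; split=> [|w|d Dd]; first exact: minimal_sublinear_linear.
  by apply: le_trans (lr w) _; exact: inf_regularization_le_self.
have := sublinearN_le _ d.1 lmin.1.
have := inf_regularization_le _ _ (- d.1) _ sq cD Dd.
rewrite addNr sublinear0// sub0r.
by have := lr (- d.1); lra.
Qed.

End Sublinear.

(** * Convex cones, distances to sets, and the feasibility error bound *)

Section Cones.
Context {R : realType} {E : normedModType R}.
Implicit Types (A Q : set E) (x y : E).

Lemma convex_setP (M : lmodType R) (A : set M) (t : R) (x y : M) :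
  convex_set A -> 0 <= t <= 1 -> A x -> A y -> A (t *: x + (1 - t) *: y).
Proof.
move=> cA /andP[t0 t1] Ax Ay.
have := set_mem (cA _ _ (Itv01 t0 t1) (mem_set Ax) (mem_set Ay)).
by [].
Qed.

Lemma convex_coneZ Q (t : R) x : convex_cone Q -> 0 < t -> Q x -> Q (t *: x).
Proof. by case=> [[_ QZ] _] /QZ; exact. Qed.

Lemma convex_coneD Q x y : convex_cone Q -> Q x -> Q y -> Q (x + y).
Proof.
move=> cQ Qx Qy; have h01 : 0 <= (2^-1 : R) <= 1 by lra.
have := convex_setP _ _ _ _ _ cQ.2 h01 Qx Qy.
move=> /(convex_coneZ _ 2 _ cQ (ltr0Sn _ 1)).
have -> : 1 - 2^-1 = 2^-1 :> R by lra.
by rewrite -scalerDr scalerA mulfV// scale1r.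
Qed.

Lemma closed_within A x : closed A ->
  (forall e : R, 0 < e -> exists2 a, A a & `|x - a| < e) -> A x.
Proof.
move=> cA xA; rewrite (closure_id A).1//.
move=> B /nbhs_ballP[e e0 xB]; have [a Aa xa] := xA e e0.
by exists a; split=> //; apply: xB; rewrite -ball_normE.
Qed.

(** Small positive multiples of any element of the cone converge to the origin. *)
Lemma closed_cone0 Q : cone Q -> closed Q -> Q 0.
Proof.
move=> [[x Qx] QZ] cQ; apply: closed_within => // e e0.
pose t := e / (1 + `|x|).
have x1 : 0 < 1 + `|x| by rewrite ltr_pwDl.
have t0 : 0 < t by rewrite divr_gt0.
exists (t *: x); first exact: QZ.
rewrite sub0r normrN normrZ gtr0_norm// /t mulrAC ltr_pdivrMr//.
by rewrite ltr_pM2l// ltrDr.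
Qed.

(* Adding up [g + b_n = c_(n+1) + b_(n+1)] with [c_n] in [Q] keeps
   [n *: g] within [s] of [Q]; divide by [n]. *)
Lemma ball_within_cancel Q (s : R) x : convex_cone Q -> closed Q -> 0 <= s ->
  (forall b, `|b| <= s -> exists2 c, Q c & `|x + b - c| <= s) -> Q x.
Proof.
move=> cQ clQ s0 xQ.
have h n : exists2 b, `|b| <= s & Q (n%:R *: x - b).
  elim: n => [|n [b bs Qb]].
    by exists 0; rewrite ?normr0// scale0r subr0; exact: closed_cone0 cQ.1 clQ.
  have [c Qc xbc] := xQ b bs; exists (x + b - c) => //.
  rewrite (_ : _ - _ = n%:R *: x - b + c); first exact: convex_coneD.
  by rewrite -natr1 scalerDl scale1r !opprD opprK !addrA addrK addrAC.
apply: closed_within => // e e0.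
have se0 : 0 <= s / e by exact: divr_ge0 s0 (ltW e0).
have [n sn] : exists n : nat, s / e < n%:R.
  exists (Num.bound (s / e)); exact: archi_boundP.
have n0 : 0 < n%:R :> R by exact: le_lt_trans sn.
have [b bs Qb] := h n; exists (n%:R^-1 *: (n%:R *: x - b)).
  by apply: convex_coneZ => //; rewrite invr_gt0.
rewrite scalerBr scalerA mulVf ?gt_eqF// scale1r opprB addrC subrK.
rewrite normrZ gtr0_norm ?invr_gt0// ltr_pdivrMl//.
by apply: le_lt_trans bs _; rewrite -ltr_pdivrMr.
Qed.

(** The distance to a set need not be attained, hence the strictly larger radius [s]. *)
Lemma edist_inf_leW A x (r s : R) : (edist_inf A x <= r%:E)%E -> r < s ->
  exists2 a, A a & `|x - a| < s.
Proof.
move=> xr rs; have /ereal_inf_lt[_ [a Aa <-] xas] : (edist_inf A x < s%:E)%E.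
  by apply: le_lt_trans xr _; rewrite lte_fin.
by exists a => //; move/edist_lt_ball: xas; rewrite -ball_normE.
Qed.

Lemma edist_inf_le_norm A x a (r : R) : A a -> `|x - a| <= r ->
  (edist_inf A x <= r%:E)%E.
Proof.
move=> Aa xr; apply/lee_addgt0Pr => e e0.
apply: le_trans (ereal_inf_lbound _) _; first by exists a.
have r0 : 0 <= r by exact: le_trans (normr_ge0 _) xr.
rewrite -EFinD; apply: edist_fin; first exact: ltr_wpDl.
by rewrite -ball_normE /=; apply: le_lt_trans xr _; rewrite ltrDl.
Qed.

End Cones.

(* One step of the increase property, of length [r = 2 rho / (alpha - 1)],
   already restores feasibility: [B(G z, alpha r)] lies within
   [r + rho < alpha r] of [C], and the common radius cancels. *)
Lemma metrically_increasing_error_bound {R : realType}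
    {X Z : normedModType R} (C : set Z) (S : set X) (G : X -> set Z) (x0 : X) :
  convex_cone C -> closed C -> metrically_increasing C S G x0 ->
  exists delta kappa : R, [/\ 0 < delta, 0 < kappa &
    forall x rho, S x -> `|x0 - x| <= delta -> 0 < rho < delta ->
      (forall y, G x y -> exists2 c, C c & `|y - c| <= rho) ->
      exists z, [/\ S z, `|x - z| <= kappa * rho & G z `<=` C]].
Proof.
move=> cC clC [delta [alpha [d0 a1 incr]]].
have a10 : 0 < alpha - 1 by rewrite subr_gt0.
pose kappa := 2 / (alpha - 1).
have k0 : 0 < kappa by rewrite divr_gt0.
(* The bound [delta / kappa] on [rho] keeps the step [kappa * rho] below [delta]. *)
exists (Num.min delta (delta / kappa)), kappa.
split; rewrite ?lt_min ?d0 ?divr_gt0//.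
move=> x rho Sx; rewrite le_min => /andP[x0x _].
rewrite lt_min => /and3P[rho0 _ rhod] Grho.
have r0 : 0 < kappa * rho by rewrite mulr_gt0.
have rd : 0 < kappa * rho < delta by rewrite r0/= mulrC -ltr_pdivlMr.
have [z [xz Sz] Gz] := incr x _ (conj x0x Sx) rd.
exists z; split=> // g Gzg.
apply: (ball_within_cancel _ (alpha * (kappa * rho)) _ cC clC) => [|b bs].
  by rewrite mulr_ge0 ?ltW// (lt_trans ltr01).
have /Gz/edist_inf_leW : enlargement (G z) (alpha * (kappa * rho)) (g + b).
  by apply: (edist_inf_le_norm _ _ g) => //; rewrite addrC addKr.
(* One [rho] pays for the unattained distance and another for the distance from [G x] to [C]; this
   is the 2 in [kappa]. *)
case/(_ (kappa * rho + rho)); first by rewrite ltrDl.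
move=> _ [y Gy [c Cc <-]] gbyc; have [c' Cc' yc'] := Grho y Gy.
exists (c' + c); first exact: convex_coneD.
have -> : alpha * (kappa * rho) = (kappa * rho + rho) + rho.
  by rewrite /kappa; field; rewrite gt_eqF.
have -> : g + b - (c' + c) = (g + b - (y + c)) + (y - c').
  by rewrite (addrC y) (opprD c) (addrA (g + b)) subrKA opprD addrA addrAC.
exact: le_trans (ler_normD _ _) (lerD (ltW gbyc) yc').
Qed.

(** * Approximating points along feasible directions by feasible points *)

Section FeasibleDirections.
Context {R : realType}.
Implicit Types X Y Z : normedModType R.

(** The radial cone rather than the contingent one: the error bound has to start from points
    [x + t *: v] lying in [S]. *)
Definition feasible_direction {X} (S : set X) (x : X) : set X :=
  [set v | \forall t \near (0 : R)^'+, S (x + t *: v)].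

Lemma near0_normZ {X} (v : X) (e : R) : 0 < e ->
  \forall t \near (0 : R)^'+, `|t *: v| <= e.
Proof.
move=> e0; have v1 : 0 < 1 + `|v| by rewrite ltr_pwDl.
have e1 : 0 < e / (1 + `|v|) by rewrite divr_gt0.
near=> t; have t0 : 0 < t by [].
rewrite normrZ gtr0_norm//; apply: le_trans (_ : t * (1 + `|v|) <= _).
  by rewrite ler_pM2l// lerDr.
rewrite -ler_pdivlMr//; near: t; exact: nbhs_right_le.
Unshelve. all: by end_near. Qed.

(** As [C] is convex, the maps whose value at [v] is within [s] of [C] form a convex set, which
    therefore contains the hull. *)
Lemma convex_hull_within {X Z} (C : set Z) (p : nat) (L : 'I_p -> X -> Z)
    (v : X) (s : R) (g : X -> Z) : convex_set C ->
  (forall i, exists2 c, C c & `|L i v - c| <= s) ->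
  convex_hull (range L) g -> exists2 c, C c & `|g v - c| <= s.
Proof.
move=> cC Lvs /(_ [set h | exists2 c, C c & `|h v - c| <= s]); apply; split;
    last first.
  by move=> _ [i _ <-]; exact: Lvs.
move=> x y l /set_mem[c Cc xc] /set_mem[d Cd yd].
apply/mem_set.
have l01 : 0 <= (l%:num : R) <= 1 by apply/andP.
exists ((l%:num : R) *: c + (1 - (l%:num : R)) *: d); first exact: convex_setP.
rewrite -[X in `|X - _|]/((l%:num : R) *: x v + (1 - (l%:num : R)) *: y v).
rewrite opprD addrACA -!scalerBr; apply: le_trans (ler_normD _ _) _.
rewrite !normrZ !ger0_norm ?subr_ge0//.
apply: le_trans (lerD (ler_wpM2l _ xc) (ler_wpM2l _ yd)) _; rewrite ?subr_ge0//.
by rewrite -mulrDl addrC subrK mul1r.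
Qed.

(** Points of [G (x0 + t *: v)] split into a point of [C], [t] times a fan value within [s] of [C],
    and a remainder absorbed by [t * (s' - s)]. *)
Lemma outer_prederivative_within {X Z} (C : set Z) (G H : X -> set Z)
    (p : nat) (L : 'I_p -> X -> Z) (x0 v : X) (s s' : R) :
  convex_cone C -> outer_prederivative G x0 H ->
  fan_generated_by H (convex_hull (range L)) -> G x0 `<=` C ->
  (forall i, exists2 c, C c & `|L i v - c| <= s) -> s < s' ->
  \forall t \near (0 : R)^'+, forall y, G (x0 + t *: v) y ->
    exists2 c, C c & `|y - c| <= t * s'.
Proof.
move=> cC [Hhom HG] Hfan G0C Lvs ss'.
have v1 : 0 < 1 + `|v| by rewrite ltr_pwDl.
pose eps := (s' - s) / (1 + `|v|).
have eps0 : 0 < eps by rewrite divr_gt0// subr_gt0.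
have [d d0 Hd] := HG _ eps0.
near=> t; have t0 : 0 < t by [].
have tvd : `|t *: v| <= d by near: t; exact: near0_normZ.
have xd : cball x0 d (x0 + t *: v).
  by rewrite /cball /closed_ball_/= opprD addrA subrr sub0r normrN.
move=> y /(Hd _ xd); rewrite [x0 + _]addrC addrK.
move=> [_ [g Gg [h Hh <-]] [_ [b b1 <-] <-]].
move: Hh; rewrite Hhom// => -[w]; rewrite Hfan => -[l lL <-] <-.
have [c Cc hc] := convex_hull_within _ _ _ _ _ _ cC.2 Lvs lL.
exists (g + t *: c).
  by apply: convex_coneD (G0C _ Gg) _ => //; exact: convex_coneZ.
rewrite -(addrA g) opprD addrACA subrr add0r addrAC -scalerBr.
apply: le_trans (ler_normD _ _) _.
move: b1; rewrite /cball /closed_ball_/= sub0r normrN => b1.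
have etv0 : 0 <= eps * (t * `|v|).
  exact: mulr_ge0 (ltW eps0) (mulr_ge0 (ltW t0) (normr_ge0 _)).
rewrite (normrZ t (l v - c)) (normrZ t v) (gtr0_norm t0) normrZ.
rewrite (ger0_norm etv0).
have -> : t * s' = t * s + eps * (t * (1 + `|v|)).
  by rewrite /eps; field; rewrite gt_eqF.
apply: lerD; first by rewrite ler_pM2l.
rewrite -mulrA ler_pM2l// -mulrA ler_pM2l//.
by apply: le_trans (ler_wpM2l (normr_ge0 _) b1) _; rewrite mulr1 lerDr.
Unshelve. all: by end_near. Qed.

(** The error bound is applied at [x0 + t *: v] with [rho = t * s']; its constant [kappa] does not
    depend on [v]. *)
Lemma feasible_approximation {X Z} (C : set Z) (S : set X) (G H : X -> set Z)
    (p : nat) (L : 'I_p -> X -> Z) (x0 : X) :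
  convex_cone C -> closed C -> metrically_increasing C S G x0 ->
  outer_prederivative G x0 H -> fan_generated_by H (convex_hull (range L)) ->
  G x0 `<=` C ->
  exists2 kappa : R, 0 < kappa & forall v s s', feasible_direction S x0 v ->
    (forall i, exists2 c, C c & `|L i v - c| <= s) -> 0 <= s -> s < s' ->
    \forall t \near (0 : R)^'+, exists2 z, feasible_set S G C z &
      `|x0 + t *: v - z| <= kappa * (t * s').
Proof.
move=> cC clC Ginc Gpre Hfan G0C.
have [d [kappa [d0 k0 Hk]]] :=
  metrically_increasing_error_bound _ _ _ _ cC clC Ginc.
exists kappa => // v s s' Sv Lvs s0 ss'.
have s'0 : 0 < s' by exact: le_lt_trans ss'.
have Gt :=
  outer_prederivative_within _ _ _ _ _ _ _ _ _ cC Gpre Hfan G0C Lvs ss'.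
near=> t; have t0 : 0 < t by [].
have [|||y|z [Sz xz Gz]] := Hk (x0 + t *: v) (t * s').
- by near: t.
- by rewrite opprD addrA subrr sub0r normrN; near: t; exact: near0_normZ.
- rewrite mulr_gt0//= -ltr_pdivlMr//; near: t; apply: nbhs_right_lt.
  by rewrite divr_gt0.
- by move: y; near: t.
by exists z.
Unshelve. all: by end_near. Qed.

Lemma differentiable_expansion {X Y} (f : X -> Y) (x0 : X) (e : R) :
  differentiable f x0 -> 0 < e ->
  exists2 d : R, 0 < d & forall x, `|x - x0| < d ->
    `|f x - f x0 - 'd f x0 (x - x0)| <= e * `|x - x0|.
Proof.
move=> df e0; have /eqaddoP/(_ _ e0)/nbhs_ballP[d d0 Hd] := diff_locally df.
exists d => // x xd; have /Hd : ball 0 d (x - x0).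
  by rewrite -ball_normE /= sub0r normrN.
rewrite /= -[(f \o shift x0 - _) _]/
  (f (x - x0 + x0) - (f x0 + 'd f x0 (x - x0))).
by rewrite subrK opprD addrA.
Qed.

End FeasibleDirections.

(** * Exact penalization at a weakly efficient point *)

Section PrimalInequality.
Context {R : realType}.
Implicit Types X Y Z : normedModType R.

(** Scaling by [t] puts the ball of radius [rho * t] around [t *: e] inside [K], and adding [k]
    preserves this. The case [k = 0] is separate because [K] may omit the origin. *)
Lemma convex_cone_interior {Y} (K : set Y) (e k u : Y) (rho t : R) :
  convex_cone K -> ball e rho `<=` K -> 0 < t -> k = 0 \/ K k ->
  `|u| < rho * t -> K° (k + t *: e + u).
Proof.
move=> cK eK t0 Kk ut; apply/nbhs_ballP; exists (rho * t - `|u|) => /=.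
  by rewrite subr_gt0.
move=> y; rewrite -ball_normE /= ltrBrDr => yu.
have : K (t *: (e + t^-1 *: (y - (k + t *: e)))).
  apply: convex_coneZ => //; apply: eK.
  rewrite -ball_normE /= opprD addrA subrr sub0r normrN normrZ.
  rewrite gtr0_norm ?invr_gt0// ltr_pdivrMl// mulrC; apply: le_lt_trans yu; rewrite distrC.
  rewrite (_ : k + t *: e - y = (k + t *: e + u - y) - u).
    exact: ler_normB.
  by rewrite [RHS]addrAC addrK.
rewrite scalerDr scalerA mulfV ?gt_eqF// scale1r addrC opprD addrA subrK => Ky.
case: Kk => [k0|Kk]; first by rewrite -(subr0 y) -k0.
by rewrite -(subrK k y); exact: convex_coneD.
Qed.

(** If the inequality failed, a small step along [v], corrected to a feasible [z], would put
    [f x0 - f z] in the interior of [K]. The weight [M] is the Lipschitz constant of the derivative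
    times the error-bound constant. *)
Lemma primal_inequality {X Y Z} (K : set Y) (C : set Z) (S : set X)
    (f : X -> Y) (G H : X -> set Z) (p : nat) (L : 'I_p -> X -> Z) (x0 : X)
    (e : Y) (rho : R) :
  convex_cone K -> ball e rho `<=` K -> convex_cone C -> closed C ->
  locally_weakly_efficient f K (feasible_set S G C) x0 ->
  metrically_increasing C S G x0 -> outer_prederivative G x0 H ->
  fan_generated_by H (convex_hull (range L)) -> differentiable f x0 ->
  exists2 M : R, 0 < M & forall v k t c, feasible_direction S x0 v ->
    k = 0 \/ K k -> 0 <= t -> (forall i, C (c i)) ->
    rho * t <= `|'d f x0 v + k + t *: e| + M * \sum_(i < p) `|L i v - c i|.
Proof.
move=> cK eK cC clC [[Sx0 Gx0] [d1 d10 eff]] Ginc Gpre Hfan df.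
have [kappa k0 approx] :=
  feasible_approximation _ _ _ _ _ _ _ cC clC Ginc Gpre Hfan Gx0.
have [l l0 Df_le] := linear_lipschitz (diff_continuous df).
exists (l * kappa); first exact: mulr_gt0.
have M0 : 0 < l * kappa by exact: mulr_gt0.
move=> v k t c Sv Kk; rewrite le_eqVlt => /predU1P[<- _|t0 Cc].
  by rewrite mulr0 addr_ge0// mulr_ge0 ?(ltW M0)// sumr_ge0.
rewrite leNgt; apply/negP => gap.
set A := `| _ + _ + _| in gap; set s := \sum_(i < p) _ in gap.
set M := l * kappa in M0 gap.
have s0 : 0 <= s by exact: sumr_ge0.
pose g := rho * t - (A + M * s).
have g0 : 0 < g by rewrite subr_gt0.
(* Passing from [s] to [s'] costs [g / 4] after weighting by [M]; the linearization error below
   costs another [g / 4], so half of the gap [g] remains. *)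
pose s' := s + g / (4 * M).
have ss' : s < s' by rewrite ltrDl divr_gt0// mulr_gt0.
have s'0 : 0 < s' by exact: le_lt_trans ss'.
(* The distance from [z] to [x0] will be at most [tau * N], so slope [theta] gives an error of at
   most [tau * g / 4]. *)
pose N := 1 + `|v| + kappa * s'.
have N0 : 0 < N.
  by rewrite ltr_wpDr ?ltr_pwDl// mulr_ge0// ltW.
pose theta := g / (4 * N).
have th0 : 0 < theta by rewrite divr_gt0// mulr_gt0.
have [d d0 fexp] := differentiable_expansion _ _ _ df th0.
have Lvs i : exists2 c, C c & `|L i v - c| <= s.
  exists (c i) => //; rewrite /s (bigD1 i)//= lerDl.
  by rewrite sumr_ge0.
have := approx v s s' Sv Lvs s0 ss'.
have : \forall tau \near (0 : R)^'+, tau * N < Num.min d d1.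
  near=> tau; rewrite -ltr_pdivlMr//; near: tau; apply: nbhs_right_lt.
  by rewrite divr_gt0// lt_min d0.
move=> small /(filterI small)/(filterI (nbhs_right_gt 0))/filter_ex.
move=> [tau [tau0 [+ [z [Sz Gz] xz]]]]; rewrite lt_min => /andP[taud taud1].
have zx0 : `|z - x0| <= tau * N.
  rewrite -(subrK (x0 + tau *: v) z) -addrA [x0 + _]addrC addrK [_ + x0]addrC.
  apply: le_trans (ler_normD _ _) _; rewrite distrC normrZ gtr0_norm//.
  apply: le_trans (lerD xz (lexx _)) _; rewrite /N !mulrDr.
  by rewrite [kappa * (tau * _)]mulrCA; nra.
have /fexp fz : `|z - x0| < d by exact: le_lt_trans zx0 taud.
pose r := f z - f x0 - tau *: 'd f x0 v.
have r_le : `|r| <= tau * (g / 4 + M * s').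
  have -> : r = (f z - f x0 - 'd f x0 (z - x0)) + 'd f x0 (z - (x0 + tau *: v)).
    rewrite (opprD x0) (addrA z) (linearB ('d f x0) (z - x0)) linearZ /=.
    by rewrite addrA subrK.
  apply: le_trans (ler_normD _ _) _; rewrite mulrDr; apply: lerD.
    apply: le_trans fz _; apply: le_trans (ler_wpM2l (ltW th0) zx0) _.
    rewrite le_eqVlt; apply/orP; left; apply/eqP.
    by rewrite /theta; field; rewrite gt_eqF.
  apply: le_trans (Df_le _) _; rewrite distrC.
  apply: le_trans (ler_wpM2l (ltW l0) xz) _.
  by rewrite (mulrCA kappa) (mulrCA l) /M !mulrA.
have Ms' : M * s' = M * s + g / 4.
  by rewrite /s'; field; rewrite gt_eqF.
have : (f @` (feasible_set S G C `&` cball x0 d1) `&`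
    [set f x0 - k | k in K°]) (f z).
  split.
    exists z => //; split=> //; rewrite /cball /closed_ball_/= distrC.
    by apply: le_trans zx0 (ltW _).
  (* [u] is what remains of [f x0 - f z] after removing [tau *: k + (tau * t) *: e]; its norm is at
     most [tau * (rho * t - g / 2)]. *)
  pose u := - (tau *: ('d f x0 v + k + t *: e)) - r.
  exists (tau *: k + (tau * t) *: e + u).
    apply: (convex_cone_interior _ _ _ _ _ _ cK eK); first exact: mulr_gt0.
      case: Kk => [->|Kk]; first by left; rewrite scaler0.
      by right; exact: convex_coneZ.
    apply: le_lt_trans (ler_normB _ _) _; rewrite normrN normrZ gtr0_norm//.
    rewrite -/A; apply: le_lt_trans (lerD (lexx _) r_le) _.
    rewrite -mulrDr [rho * _]mulrCA ltr_pM2l// Ms'; rewrite /g in g0 *; lra.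
  have -> : tau *: k + (tau * t) *: e + u = f x0 - f z.
    rewrite /u /r -['d f x0 v + k + _]addrA !scalerDr scalerA.
    rewrite [RHS](_ : _ = - (f z - f x0)); last by rewrite opprB.
    move: (tau *: 'd f x0 v) (tau *: k) ((tau * t) *: e) (f z - f x0).
    move=> w a b h; rewrite (opprD w) (opprB h) (addrACA (- w)) addNr add0r.
    by rewrite addrA subrr sub0r.
  exact: subKr.
by rewrite eff.
Unshelve. all: by end_near. Qed.

End PrimalInequality.

(** * Feasible directions of a locally convex set *)

Section LocallyConvex.
Context {R : realType} {X : normedModType R} (S : set X) (x0 : X).
Hypotheses (Sx0 : S x0) (S_conv : locally_convex_near S x0).

(** By local convexity, a single nearby point of [S] on the ray carries the whole segment back to
    [x0]. *)
Lemma feasible_direction_radius : exists2 r : R, 0 < r &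
  forall t v, 0 < t -> `|t *: v| <= r -> S (x0 + t *: v) ->
    feasible_direction S x0 v.
Proof.
have [r r0 cS] := S_conv; exists r => // t v t0 tvr Sv.
have Bv : (S `&` cball x0 r) (x0 + t *: v).
  by split=> //; rewrite /cball /closed_ball_/= opprD addrA subrr sub0r normrN.
have B0 : (S `&` cball x0 r) x0.
  by split=> //; rewrite /cball /closed_ball_/= subrr normr0 ltW.
rewrite /feasible_direction/=; near=> s; have s0 : 0 < s by [].
have st : 0 <= s / t <= 1.
  apply/andP; split; first exact: divr_ge0 (ltW s0) (ltW t0).
  by rewrite ler_pdivrMr// mul1r; near: s; exact: nbhs_right_le.
have [+ _] := convex_setP _ _ _ _ _ cS st Bv B0.
rewrite scalerDr scalerA divfK ?gt_eqF// addrAC -scalerDl.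
by rewrite [s / t + _]addrC subrK scale1r.
Unshelve. all: by end_near. Qed.

Lemma feasible_direction0 : feasible_direction S x0 0.
Proof. by rewrite /feasible_direction/=; near=> t; rewrite scaler0 addr0.
Unshelve. all: by end_near. Qed.

Lemma feasible_directionZ (a : R) v : 0 < a ->
  feasible_direction S x0 v -> feasible_direction S x0 (a *: v).
Proof.
move=> a0 Sv; have [r r0 Sr] := feasible_direction_radius.
have /filter_ex[t [t0 [Stv tvr]]] :
    \forall t \near (0 : R)^'+, 0 < t /\ S (x0 + t *: v) /\ `|t *: v| <= r.
  by near=> t; split=> //; split; near: t => //; exact: near0_normZ.
have ta : (t / a) *: (a *: v) = t *: v by rewrite scalerA divfK ?gt_eqF.
by apply: (Sr (t / a)); rewrite ?ta// divr_gt0.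
Unshelve. all: by end_near. Qed.

(** The midpoint of [x0 + t *: v] and [x0 + t *: w] shows that half of [v + w] is feasible; then
    double. *)
Lemma feasible_directionD v w : feasible_direction S x0 v ->
  feasible_direction S x0 w -> feasible_direction S x0 (v + w).
Proof.
move=> Sv Sw; have [r r0 cS] := S_conv.
have [r' r'0 Sr] := feasible_direction_radius.
have /filter_ex[t [t0 [vw [/[dup] vr Bv Bw]]]] : \forall t \near (0 : R)^'+,
    0 < t /\ `|t *: (2^-1 *: (v + w))| <= r' /\
    (S `&` cball x0 r) (x0 + t *: v) /\ (S `&` cball x0 r) (x0 + t *: w).
  near=> t; split=> //; split; first by near: t; exact: near0_normZ.
  rewrite /cball /closed_ball_/= !opprD !addrA subrr !sub0r !normrN.
  split; split; near: t => //; exact: near0_normZ.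
have h01 : 0 <= (2^-1 : R) <= 1 by lra.
have := convex_setP _ _ _ _ _ cS h01 Bv Bw.
have -> : 1 - 2^-1 = 2^-1 :> R by lra.
rewrite -scalerDr addrACA scalerDr -mulr2n -(scaler_nat 2 x0) scalerA mulVf//.
rewrite scale1r.
rewrite -scalerDr scalerA [2^-1 * t]mulrC -scalerA => -[Svw _].
have := Sr _ _ t0 vw Svw.
move=> /(feasible_directionZ 2 _ (ltr0Sn _ 1)).
by rewrite scalerA mulfV// scale1r.
Unshelve. all: by end_near. Qed.

(** The directions [v_ n] approximating a contingent vector are eventually feasible, since
    [t_ n *: v_ n] tends to 0; continuity of [q] gives the limit. *)
Lemma contingent_cone_ge0 (q : X -> R^o) : continuous q ->
  (forall v, feasible_direction S x0 v -> 0 <= q v) ->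
  forall v, contingent_cone S x0 v -> 0 <= q v.
Proof.
move=> cq q0 v [v_ [t_ [vv t0 tt Sv]]].
have [r r0 Sr] := feasible_direction_radius.
have tv0 : t_ n *: v_ n @[n --> \oo] --> (0 : X).
  by rewrite -(scale0r v); exact: cvgZ.
have qv : q (v_ n) @[n --> \oo] --> q v by apply: cvg_comp vv (cq v).
apply: (cvgr_to_ge qv); near=> n; apply: q0; apply: (Sr (t_ n)) => //.
near: n; apply: cvgr0_norm_le tv0 _ r0.
Unshelve. all: by end_near. Qed.

End LocallyConvex.

(** * Bounded operators as plain functions *)

Section BoundedOperators.
Context {R : realType}.
Implicit Types E F : normedModType R.

(** A one-sided bound is enough: at [- x] it bounds [q x] from below. *)
Lemma bounded_operatorP {E} (q : E -> R^o) (M : R) : linear q ->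
  (forall x, q x <= M * `|x|) -> bounded_operator q.
Proof.
move=> lq qM; split=> //.
pose ql : {linear E -> R^o} := HB.pack q (GRing.isLinear.Build _ _ _ _ q lq).
apply: (@bounded_linear_continuous _ _ _ ql).
apply/linear_boundedP; near=> r => x.
have Mr x' : q x' <= r * `|x'|.
  by apply: le_trans (qM x') _; apply: ler_wpM2r => //; near: r.
rewrite ler_norml Mr andbT lerNl -(linearN ql) -[`|x|]normrN.
exact: Mr.
Unshelve. all: by end_near. Qed.

Lemma bounded_operator_comp {E F} {G : normedModType R} (g : F -> G)
    (f : E -> F) :
  bounded_operator g -> bounded_operator f -> bounded_operator (g \o f).
Proof.
move=> [lg cg] [lf cf]; split; first by move=> a x y; rewrite /= lf lg.
by move=> x; apply: continuous_comp; [exact: cf|exact: cg].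
Qed.

Lemma bounded_operatorD {E F} (f g : E -> F) :
  bounded_operator f -> bounded_operator g -> bounded_operator (f + g).
Proof.
move=> [lf cf] [lg cg]; split; last first.
  by move=> x; apply: cvgD; [exact: cf|exact: cg].
by move=> a x y; rewrite !fctE lf lg scalerDr addrACA.
Qed.

Lemma bounded_operator_sum {E F} (p : nat) (f : 'I_p -> E -> F) :
  (forall i, bounded_operator (f i)) -> bounded_operator (\sum_(i < p) f i).
Proof.
move=> fb; apply: (big_ind bounded_operator) => //;
  last exact: bounded_operatorD.
split; first by move=> a x y; rewrite scaler0 addr0.
by move=> x; exact: cvg_cst.
Qed.

Lemma operator_norm0 {E F} : operator_norm (0 : E -> F) = 0.
Proof.
rewrite /operator_norm (_ : [set _ | _ in _] = [set 0]) ?sup1//.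
apply/seteqP; split=> [_ [x _ <-]|_ ->]; first by rewrite /= normr0.
by exists 0; rewrite /= ?normr0// /cball /closed_ball_/= subrr normr0 ler01.
Qed.

End BoundedOperators.

Lemma linear_map0 {R : realType} {E' E : lmodType R} {g : E' -> E} :
  linear g -> g 0 = 0.
Proof.
move=> lg; have := lg (-1) 0 0.
by rewrite scaleN1r oppr0 addr0 scaleN1r addNr.
Qed.

Lemma linear_mapD {R : realType} {E' E : lmodType R} {g : E' -> E} x y :
  linear g -> g (x + y) = g x + g y.
Proof. by move=> lg; have := lg 1 x y; rewrite !scale1r. Qed.

Lemma linear_mapZ {R : realType} {E' E : lmodType R} {g : E' -> E} a x :
  linear g -> g (a *: x) = a *: g x.
Proof.
by move=> lg; have := lg a x 0; rewrite !addr0 (linear_map0 lg) addr0.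
Qed.

(** * Extraction of the multipliers from the primal inequality *)

Section Multipliers.
Context {R : realType} {X Y Z : normedModType R}.
Variables (K : set Y) (C : set Z) (F : set X) (p : nat).
Variables (L : 'I_p -> X -> Z) (T : X -> Y) (e : Y) (rho M : R).
Hypotheses (cK : convex_cone K) (cC : convex_cone C) (clC : closed C).
Hypotheses (F0 : F 0) (FD : forall v w, F v -> F w -> F (v + w)).
Hypothesis (FZ : forall (a : R) v, 0 < a -> F v -> F (a *: v)).
Hypotheses (linT : linear T) (linL : forall i, linear (L i)).
Hypotheses (rho0 : 0 < rho) (M0 : 0 < M).
Hypothesis primal : forall v k t c, F v -> k = 0 \/ K k -> 0 <= t ->
  (forall i, C (c i)) ->
  rho * t <= `|T v + k + t *: e| + M * \sum_(i < p) `|L i v - c i|.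

Let W : lmodType R := (Y * {ffun 'I_p -> Z})%type.
Let penalty (w : W) : R := `|w.1| + M * \sum_(i < p) `|w.2 i|.

(** Each choice of [v], [k], [t], [c] records the residuals in [primal] with their lower bound
    [rho * t]; allowing [k = 0] puts the origin in this cone. *)
Let constraints : set (W * R) := [set d | exists v k t c,
  [/\ F v, k = 0 \/ K k, 0 <= t, forall i, C (c i) &
    d = ((T v + k + t *: e, [ffun i => L i v - c i]), rho * t)]].

Let penalty_sublinear : sublinear penalty.
Proof.
split=> [x y|t x t0]; rewrite /penalty /=.
  rewrite addrACA -mulrDr -big_split /=; apply: lerD; first exact: ler_normD.
  rewrite ler_pM2l//; apply: ler_sum => i _; rewrite ffunE; exact: ler_normD.
rewrite normrZ gtr0_norm// mulrDr mulrCA (mulr_sumr _ _ _ t); congr (_ + _ * _).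
by apply: eq_bigr => i _; rewrite ffunE normrZ gtr0_norm.
Qed.

Let constraints_cone : constraint_cone constraints penalty.
Proof.
have C0 : C 0 by exact: closed_cone0 cC.1 clC.
split.
- exists 0, 0, 0, (fun=> 0); split=> //; first by left.
  rewrite mulr0 scale0r (linear_map0 linT) !addr0; congr (_, _, _).
  by apply/ffunP => i; rewrite !ffunE (linear_map0 (linL i)) subr0.
- move=> _ _ [v [k [t [c [Fv Kk t0 Cc ->]]]]] [w [l [s [d [Fw Kl s0 Cd ->]]]]].
  exists (v + w), (k + l), (t + s), (fun i => c i + d i).
  split.
  + exact: FD.
  + case: Kk Kl => [->|Kk] [->|Kl]; rewrite ?addr0 ?add0r; first by left.
    - by right.
    - by right.
    - by right; exact: convex_coneD.
  + exact: addr_ge0.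
  + by move=> i; exact: convex_coneD.
  + rewrite /= mulrDr scalerDl (linear_mapD _ _ linT); congr (_, _, _).
      by rewrite addrACA; congr (_ + _); rewrite addrACA.
    apply/ffunP => i; rewrite !ffunE (linear_mapD _ _ (linL i)).
    by rewrite opprD addrACA.
- move=> a _ a0 [v [k [t [c [Fv Kk t0 Cc ->]]]]].
  exists (a *: v), (a *: k), (a * t), (fun i => a *: c i); split.
  + exact: FZ.
  + by case: Kk => [->|Kk]; [left; rewrite scaler0|right; exact: convex_coneZ].
  + by rewrite mulr_ge0// ltW.
  + by move=> i; exact: convex_coneZ.
  + rewrite /= mulrCA (linear_mapZ _ _ linT) -scalerA -!scalerDr.
    congr (_, _); congr (_, _).
    by apply/ffunP => i; rewrite !ffunE (linear_mapZ _ _ (linL i)) scalerBr.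
- move=> _ [v [k [t [c [Fv Kk t0 Cc ->]]]]] /=; rewrite /penalty/=.
  under eq_bigr do rewrite ffunE.
  exact: primal.
Qed.

(** The components of a sandwiched functional are the multipliers. Its bound by [penalty] makes them
    continuous, and switching on [k], [t], [c] or [v] alone gives the four conclusions in turn. *)
Lemma multipliers_exist : exists (ys : Y -> R^o) (zs : 'I_p -> Z -> R^o),
  [/\ dual_cone K ys, ys <> 0, forall i, neg_dual_cone C (zs i) &
    forall v, F v -> 0 <= ys (T v) + \sum_(i < p) zs i (L i v)].
Proof.
have [l [linl l_le l_ge]] :=
  mazur_orlicz _ _ penalty_sublinear constraints_cone.
have C0 : C 0 by exact: closed_cone0 cC.1 clC.
pose ys y : R^o := l (y, 0).
pose single (i : 'I_p) (z : Z) : {ffun 'I_p -> Z} :=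
  [ffun j => if j == i then z else 0].
pose zs i z : R^o := l (0, single i z).
have linys : linear ys.
  move=> a x y; rewrite /ys -linl; congr l.
  by congr (_, _); rewrite /= scaler0 addr0.
have linzs i : linear (zs i).
  move=> a x y; rewrite /zs -linl; congr l; congr (_, _).
    by rewrite /= scaler0 addr0.
  by apply/ffunP => j; rewrite !ffunE; case: ifP; rewrite ?scaler0 ?addr0.
have lE y (z : {ffun 'I_p -> Z}) : l (y, z) = ys y + \sum_(i < p) zs i (z i).
  have lin2 : linear (fun x : {ffun 'I_p -> Z} => l (0, x) : R^o).
    move=> a x x'; rewrite -linl; congr l; congr (_, _).
    by rewrite /= scaler0 addr0.
  have -> : (y, z) = (y, 0) + (0, z) :> W.
    by congr (_, _); rewrite /= ?addr0 ?add0r.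
  rewrite (linear_mapD _ _ linl); congr (_ + _).
  have {1}-> : z = \sum_(i < p) single i (z i).
    apply/ffunP => j; rewrite sum_ffunE (bigD1 j)//= ffunE eqxx big1 ?addr0//.
    by move=> i ij; rewrite ffunE eq_sym (negbTE ij).
  exact: (big_morph _ (fun x x' => linear_mapD x x' lin2) (linear_map0 lin2)).
have bys : bounded_operator ys.
  apply: (bounded_operatorP _ 1 linys) => y; apply: le_trans (l_le _) _.
  rewrite /penalty /= big1 ?mulr0 ?addr0 ?mul1r// => i _.
  by rewrite ffunE normr0.
have zs_le i z : zs i z <= M * `|z|.
  apply: le_trans (l_le _) _.
  rewrite /penalty /= normr0 add0r ler_pM2l// (bigD1 i)//= big1 ?addr0.
    by rewrite ffunE eqxx.
  by move=> j ji; rewrite ffunE (negbTE ji) normr0.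
exists ys, zs; split.
- split=> // k Kk.
  have /l_ge /= : constraints
      ((T 0 + k + 0 *: e, [ffun i => L i 0 - 0]), rho * 0).
    by exists 0, k, 0, (fun=> 0); split=> //; right.
  rewrite mulr0 (linear_map0 linT) add0r scale0r addr0 lE big1 ?addr0// => i _.
  by rewrite ffunE subr0 (linear_map0 (linL i)) (linear_map0 (linzs i)).
- move=> ys0.
  (* With [t = 1] alone the constraint reads [rho <= ys e], which excludes [ys = 0]. *)
  have /l_ge /= : constraints
      ((T 0 + 0 + 1 *: e, [ffun i => L i 0 - 0]), rho * 1).
    by exists 0, 0, 1, (fun=> 0); split=> //; left.
  rewrite lE ys0 big1 ?addr0 => [|i _].
    by rewrite mulr1 leNgt rho0.
  by rewrite ffunE subr0 (linear_map0 (linL i)) (linear_map0 (linzs i)).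
- move=> i; exists (- zs i); last exact: opprK.
  have bN : bounded_operator (- zs i).
    apply: (bounded_operatorP _ M) => [a x y|z].
      by rewrite !fctE (linzs i) opprD scalerN.
    have -> : (- zs i) z = zs i (- z).
      by rewrite -(scaleN1r z) (linear_mapZ _ _ (linzs i)) scaleN1r.
    by rewrite -(normrN z); exact: zs_le.
  split=> // z Cz.
  (* Only the [i]-th residual is nonzero, equal to [- z], so [zs i (- z)] is nonnegative. *)
  have /l_ge /= : constraints ((T 0 + 0 + 0 *: e,
      [ffun j => L j 0 - (if j == i then z else 0)]), rho * 0).
    exists 0, 0, 0, (fun j => if j == i then z else 0).
    by split=> //; [left|move=> j; case: ifP].
  rewrite mulr0 (linear_map0 linT) scale0r !addr0 lE (linear_map0 linys) add0r.
  rewrite (bigD1 i)//= big1 ?addr0 => [|j ji].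
    rewrite ffunE eqxx (linear_map0 (linL i)) sub0r -(scaleN1r z).
    by rewrite (linear_mapZ _ _ (linzs i)) scaleN1r.
  rewrite ffunE (negbTE ji) subr0 (linear_map0 (linL j)).
  by rewrite (linear_map0 (linzs j)).
- move=> v Fv.
  have /l_ge /= : constraints
      ((T v + 0 + 0 *: e, [ffun i => L i v - 0]), rho * 0).
    by exists v, 0, 0, (fun=> 0); split=> //; left.
  rewrite mulr0 scale0r !addr0 lE => /le_trans; apply; rewrite lerD2l.
  by apply: ler_sum => i _; rewrite ffunE subr0.
Qed.

End Multipliers.

Theorem theorem4p4 (R : realType) (X Y Z : completeNormedModType R)
    (K : set Y) (C : set Z) (S : set X) (f : X -> Y) (G H : X -> set Z)
    (p : nat) (L : 'I_p -> X -> Z) (x0 : X)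
    (K_cone : convex_cone K) (K_proper : K != setT) (K_int : K° !=set0)
    (C_cone : convex_cone C) (C_closed : closed C) (C_proper : C != setT)
    (C_neq0 : C != [set 0])
    (S_neq0 : S !=set0) (S_closed : closed S)
    (G_neq0 : forall x, G x !=set0)
    (x0_eff : locally_weakly_efficient f K (feasible_set S G C) x0)
    (f_Bdiff : B_differentiable f x0)
    (G_lsc : \forall x \near x0, lower_semicontinuous_at G x)
    (G_incr : metrically_increasing C S G x0)
    (G_pre : outer_prederivative G x0 H)
    (S_conv : locally_convex_near S x0)
    (f_diff : differentiable f x0)
    (L_bounded : forall i, bounded_operator (L i))
    (H_fan : fan_generated_by H (convex_hull (range L)))
    (qualif : (\bigcap_(i in [set: 'I_p]) (L i @^-1` C)°) `&`
              (contingent_cone S x0)° !=set0) :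
  exists (ys : Y -> R^o) (xs : 'I_p -> X -> R^o)
         (zs : 'I_p -> nat -> Z -> R^o),
    [/\ dual_cone K ys /\ ys <> 0,
        forall i, bounded_operator (xs i),
        forall i n, neg_dual_cone C (zs i n),
        forall i, operator_norm (zs i n \o L i - xs i) @[n --> \oo] --> 0 &
        exists2 nu, normal_cone S x0 nu &
          0 = (ys \o 'd f x0) + \sum_(i < p) xs i + nu].
Proof.
have [e /nbhs_ballP[rho /= rho0 eK]] := K_int.
have [M M0 primal] := primal_inequality _ _ _ _ _ _ _ _ _ _ _ K_cone eK C_cone
  C_closed x0_eff G_incr G_pre H_fan f_diff.
have Sx0 : S x0 by case: x0_eff => -[].
have linD : linear ('d f x0) by exact: linearP.
have [ys [zs [ysK ys0 zsC ge0]]] := multipliers_exist _ _ _ _ _ _ _ _ _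
  K_cone C_cone C_closed (feasible_direction0 _ _ Sx0)
  (feasible_directionD _ _ Sx0 S_conv) (feasible_directionZ _ _ Sx0 S_conv)
  linD (fun i => (L_bounded i).1) rho0 M0 primal.
have bzs i : bounded_operator (zs i).
  have [q [[lq cq] _] <-] := zsC i; split.
    by move=> a x y; rewrite !fctE lq opprD scalerN.
  by move=> x; apply: cvgN; exact: cq.
have bD : bounded_operator ('d f x0) by split=> //; exact: diff_continuous.
have bxs i : bounded_operator (zs i \o L i) by exact: bounded_operator_comp.
exists ys, (fun i => zs i \o L i), (fun i _ => zs i); split=> //.
  by move=> i; rewrite subrr operator_norm0; exact: cvg_cst.
(* [q] is nonnegative on feasible directions, hence by continuity on the contingent cone; [- q] is
   then the required normal. *)
set q := _ + _.
have bq : bounded_operator q.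
  apply: bounded_operatorD; last exact: bounded_operator_sum.
  exact: bounded_operator_comp ysK.1 bD.
exists (- q); last by rewrite subrr.
exists q => //; split=> //; apply: (contingent_cone_ge0 _ _ Sx0 S_conv _ bq.2).
by move=> v /ge0; rewrite /q !fctE fct_sumE.
Qed.
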